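(* Let $f:\mathbb{R}^n\to\mathbb{R}$ and $c:\mathbb{R}^n\to\mathbb{R}^m$ be continuously differentiable with locally Lipschitz continuous derivatives, let $g:\mathbb{R}^n\to\mathbb{R}\cup\{\infty\}$ be proper, lower semicontinuous and prox-bounded, let $D\subset\mathbb{R}^m$ be nonempty and closed, and put $q:=f+g$. Consider the problem $$(\mathrm P)\quad \min_{x\in\mathbb{R}^n} q(x)\ \text{ subject to } c(x)\in D$$ and its reformulation with slack variable $$(\mathrm P_{\mathrm S})\quad \min_{(x,s)\in\mathbb{R}^n\times\mathbb{R}^m} q(x)\ \text{ subject to } c(x)-s=0,\ s\in D .$$ A feasible point $x^*\in\mathbb{R}^n$ of $(\mathrm P)$ is AM-stationary for $(\mathrm P)$ if and only if $(x^*,c(x^* ))$ is AM-stationary for $(\mathrm P_{\mathrm S})$.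
   Context: For $h:\mathbb{R}^N\to\mathbb{R}\cup\{\infty\}$, $\operatorname{dom}h=\{x: h(x)<\infty\}$; $h$ is proper if $\operatorname{dom}h\neq\emptyset$, and prox-bounded if it is proper and $h+\|\cdot\|^2/(2\gamma)$ is bounded below for some $\gamma>0$. For $h$ proper and lower semicontinuous and $\bar x\in\operatorname{dom}h$, the regular subdifferential is $\hat\partial h(\bar x)=\{v:\liminf_{x\to\bar x,\,x\ne\bar x}\frac{h(x)-h(\bar x)-\langle v,x-\bar x\rangle}{\|x-\bar x\|}\ge 0\}$, and the (limiting) subdifferential $\partial h(\bar x)$ is the set of $v$ for which there are $x^j\to\bar x$ with $h(x^j)\to h(\bar x)$ and $v^j\in\hat\partial h(x^j)$ with $v^j\to v$; both are empty if $\bar x\notin\operatorname{dom}h$. For a closed nonempty set $C$ with projection $\Pi_C(v)=\operatorname{argmin}_{z\in C}\|z-v\|$, the limiting normal cone at $z\in C$ is $\mathcal N_C^{\lim}(z)=\limsup_{v\to z}\operatorname{cone}(v-\Pi_C(v))$ (outer limit: all limits of $w^j\in\operatorname{cone}(v^j-\Pi_C(v^j))$ with $v^j\to z$), and $\mathcal N_C^{\lim}(z)=\emptyset$ for $z\notin C$. **AM-stationarity.** Consider a general problem ''minimize $Q(w)$ over $w\in\mathbb{R}^N$ subject to $G(w)\in C$'', with $Q:\mathbb{R}^N\to\mathbb{R}\cup\{\infty\}$ proper lower semicontinuous, $G:\mathbb{R}^N\to\mathbb{R}^M$ continuously differentiable with Jacobian $\nabla G$, and $C\subset\mathbb{R}^M$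 nonempty closed. A point $w^*$ is feasible if $w^*\in\operatorname{dom}Q$ and $G(w^* )\in C$. A feasible $w^*$ is asymptotically M-stationary (AM-stationary) if there are sequences $\{w^k\},\{\eta^k\}\subset\mathbb{R}^N$ and $\{y^k\},\{\zeta^k\}\subset\mathbb{R}^M$ such that $w^k\to w^*$, $Q(w^k)\to Q(w^* )$, $\eta^k\to0$, $\zeta^k\to0$ and, for all $k\in\mathbb{N}$, $-\nabla G(w^k)^\top y^k+\eta^k\in\partial Q(w^k)$ and $y^k\in\mathcal N_C^{\lim}(G(w^k)+\zeta^k)$. For $(\mathrm P)$ this is applied with $w=x$, $Q=q$, $G=c$, $C=D$. For $(\mathrm P_{\mathrm S})$ it is applied with $w=(x,s)$, $Q(x,s)=q(x)$, $G(x,s)=(c(x)-s,\,s)$, $C=\{0\}\times D\subset\mathbb{R}^m\times\mathbb{R}^m$. *)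

(* Defs.v *)
From HB Require Import structures.
From mathcomp Require Import all_boot all_order all_algebra.
From mathcomp Require Import all_classical all_reals all_analysis.

Set Implicit Arguments.
Unset Strict Implicit.
Unset Printing Implicit Defensive.

Import Order.TTheory GRing.Theory Num.Theory.
Import numFieldNormedType.Exports.

Local Open Scope classical_set_scope.
Local Open Scope ring_scope.

(* Vectors of R^N are row vectors.  The library's norm on ['rV[R]_N] is the   *)
(* sup norm (same topology and same Lipschitz maps as the Euclidean one);     *)
(* projections and subdifferentials use the Euclidean norm [enorm] below.     *)

Definition dotv (R : realType) (N : nat) (u v : 'rV[R]_N) : R :=
  \sum_i u 0 i * v 0 i.

Definition enorm (R : realType) (N : nat) (u : 'rV[R]_N) : R :=
  Num.sqrt (dotv u u).

(* Functions h : R^N -> R U {oo} are maps into [\bar R] which avoid [-oo].    *)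

Definition noninfty_below (R : realType) (N : nat) (h : 'rV[R]_N -> \bar R) :=
  forall x, h x != -oo%E.

Definition edom (R : realType) (N : nat) (h : 'rV[R]_N -> \bar R) :
  set 'rV[R]_N := [set x | (h x < +oo)%E].

Definition proper_fun (R : realType) (N : nat) (h : 'rV[R]_N -> \bar R) : Prop :=
  edom h !=set0.

Definition prox_bounded (R : realType) (N : nat) (h : 'rV[R]_N -> \bar R) :
    Prop :=
  proper_fun h /\
  exists2 gamma : R, 0 < gamma &
    exists b : R, forall x,
      (b%:E <= h x + (enorm x ^+ 2 / (2 * gamma))%:E)%E.

Definition reg_subdiff (R : realType) (N : nat) (h : 'rV[R]_N -> \bar R)
    (xb : 'rV[R]_N) : set 'rV[R]_N :=
  [set v | edom h xb /\
     (0 <= limf_einf (fun x : 'rV[R]_N =>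
             (h x - h xb - (dotv v (x - xb))%:E) / (enorm (x - xb))%:E)
           xb^')%E].

Definition subdiff (R : realType) (N : nat) (h : 'rV[R]_N -> \bar R)
    (xb : 'rV[R]_N) : set 'rV[R]_N :=
  [set v | edom h xb /\
     exists x_ v_ : nat -> 'rV[R]_N,
       [/\ x_ @ \oo --> xb,
           h (x_ j) @[j --> \oo] --> h xb,
           forall j, reg_subdiff h (x_ j) (v_ j) &
           v_ @ \oo --> v]].

Definition proj_set (R : realType) (M : nat) (C : set 'rV[R]_M) (v : 'rV[R]_M) :
  set 'rV[R]_M :=
  [set z | C z /\ forall z', C z' -> enorm (z - v) <= enorm (z' - v)].

Definition cone (R : realType) (M : nat) (A : set 'rV[R]_M) : set 'rV[R]_M :=
  [set w | exists2 t : R, 0 <= t & exists2 a, A a & w = t *: a].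

Definition lim_normal_cone (R : realType) (M : nat) (C : set 'rV[R]_M)
    (z : 'rV[R]_M) : set 'rV[R]_M :=
  [set w | C z /\
     exists v_ w_ : nat -> 'rV[R]_M,
       [/\ v_ @ \oo --> z,
           forall j, cone [set v_ j - p | p in proj_set C (v_ j)] (w_ j) &
           w_ @ \oo --> w]].

Definition locally_lipschitz (R : realType) (V W : normedModType R)
    (h : V -> W) : Prop :=
  forall x : V, exists2 U : set V, nbhs x U & [lipschitz h y | y in U].

Definition grad (R : realType) (N : nat) (f : 'rV[R]_N -> R)
    (x : 'rV[R]_N) : 'rV[R]_N :=
  \row_i 'd f x (delta_mx 0 i).

Section AM_stationarity.
Variables (R : realType) (N M : nat).
Variables (Q : 'rV[R]_N -> \bar R) (G : 'rV[R]_N -> 'rV[R]_M).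
Variable C : set 'rV[R]_M.

Definition feasible (w : 'rV[R]_N) : Prop := edom Q w /\ C (G w).

(* ['J G w] acts on row vectors from the right ('D_v G w = v *m 'J G w), so   *)
(* it is the transpose of the usual M x N Jacobian, and the row vector form   *)
(* of (nabla G(w))^T y is [y *m ('J G w)^T].                                  *)
Definition AM_stationary (ws : 'rV[R]_N) : Prop :=
  feasible ws /\
  exists (w_ eta : nat -> 'rV[R]_N) (y zeta : nat -> 'rV[R]_M),
    [/\ w_ @ \oo --> ws,
        Q (w_ k) @[k --> \oo] --> Q ws,
        eta @ \oo --> (0 : 'rV[R]_N),
        zeta @ \oo --> (0 : 'rV[R]_M) &
        forall k,
          subdiff Q (w_ k) (- (y k *m ('J G (w_ k))^T) + eta k) /\
          lim_normal_cone C (G (w_ k) + zeta k) (y k)].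

End AM_stationarity.

(* The pair (x, s) is [row_mx x s]. *)

Definition slack_obj (R : realType) (n m : nat) (q : 'rV[R]_n -> \bar R)
    (w : 'rV[R]_(n + m)) : \bar R :=
  q (lsubmx w).

Definition slack_map (R : realType) (n m : nat) (c : 'rV[R]_n -> 'rV[R]_m)
    (w : 'rV[R]_(n + m)) : 'rV[R]_(m + m) :=
  row_mx (c (lsubmx w) - rsubmx w) (rsubmx w).

Definition slack_set (R : realType) (m : nat) (D : set 'rV[R]_m) :
    set 'rV[R]_(m + m) :=
  [set z | lsubmx z = 0 /\ D (rsubmx z)].

(* Main.v *)
Require Import Defs.
From mathcomp Require Import all_boot all_order all_algebra.
From mathcomp Require Import all_classical all_reals all_analysis.
From mathcomp Require Import ring lra.

Set Implicit Arguments.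
Unset Strict Implicit.
Unset Printing Implicit Defensive.

Import Order.TTheory GRing.Theory Num.Theory.
Import numFieldNormedType.Exports.
Local Open Scope classical_set_scope.
Local Open Scope ring_scope.

(** In the slack problem the constraint c(x) - s = 0 carries a multiplier
    lambda and the constraint s \in D a multiplier mu.  The objective q(x) does
    not depend on s, so its subgradients at (x, s) are exactly the pairs (v, 0)
    with v a subgradient of q at x ([subdiff_slack_obj]).  The normal cone to
    {0} x D at (0, z) is the full space times the normal cone to D at z
    ([lim_normal_cone_slack_set]): lambda is free, and mu is normal to D.  By
    [jacobian_slack_map] the s-component of the stationarity condition reads
    lambda - mu + eta_s = 0, so both multipliers agree up to a vanishing error.

    From (P) to (PS): take s = c(x), both multipliers equal to y, and let the
    perturbation zeta act on the second block only.

    From (PS) to (P): keep y = mu.  Replacing lambda = mu - eta_s in the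
    x-component costs the error eta_s * J^T, which vanishes because the
    Jacobians J of c at the points x^k converge.  Since
    c(x) - s + zeta_1 = 0, the point s + zeta_2 at which mu is normal to D is
    c(x) + (zeta_1 + zeta_2), so zeta_1 + zeta_2 is the new perturbation.

    The delicate inclusion is that every (lambda, mu) with mu normal to D is a
    limiting normal of {0} x D.  Limiting normals are limits of scaled
    projection residuals t (v - p), and the residual of a point (a, v) is
    (a, v - p).  For t a to tend to lambda while a vanishes, t must tend to
    infinity, whereas the sequence defining mu may have bounded t.  Moving v
    towards its projection p keeps p a projection ([proj_set_segment]) and
    shortens the residual, so t can be enlarged at will without changing
    t (v - p). *)

(** * Entrywise convergence of matrices *)

Lemma cvg_mx (R : realType) (m n : nat) (T : Type) (F : set_system T)
    {FF : Filter F} (u : T -> 'M[R]_(m, n)) (M : 'M[R]_(m, n)) :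
  (forall i j, u t i j @[t --> F] --> M i j) -> u t @[t --> F] --> M.
Proof.
move=> uM; apply/cvg_ballP => e e0.
have : \forall t \near F, forall i j, ball (M i j) e (u t i j).
  apply: filter_forall => i; apply: filter_forall => j.
  by move/cvg_ballP : (uM i j) => /(_ _ e0).
by apply: filterS => t ?; split.
Qed.

Lemma cvg_coord {R : realType} {m n : nat} {T : Type} {F : set_system T}
    {FF : Filter F} {u : T -> 'M[R]_(m, n)} {M : 'M[R]_(m, n)} i j :
  u t @[t --> F] --> M -> u t i j @[t --> F] --> M i j.
Proof.
by move=> uM; apply: (@cvg_comp _ _ _ u (fun A : 'M[R]_(m, n) => A i j) _ _ _ uM);
  exact: coord_continuous.
Qed.

Section cvg_blocks.
Context {R : realType} {T : Type} {F : set_system T} {FF : Filter F}.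
Context {p n m : nat}.

Lemma cvg_lsubmx (w : T -> 'M[R]_(p, n + m)) (w0 : 'M[R]_(p, n + m)) :
  w t @[t --> F] --> w0 -> lsubmx (w t) @[t --> F] --> lsubmx w0.
Proof.
move=> ww; apply: cvg_mx => i j; rewrite mxE.
by under eq_cvg do rewrite mxE; exact: cvg_coord.
Qed.

Lemma cvg_rsubmx (w : T -> 'M[R]_(p, n + m)) (w0 : 'M[R]_(p, n + m)) :
  w t @[t --> F] --> w0 -> rsubmx (w t) @[t --> F] --> rsubmx w0.
Proof.
move=> ww; apply: cvg_mx => i j; rewrite mxE.
by under eq_cvg do rewrite mxE; exact: cvg_coord.
Qed.

Lemma cvg_row_mx (u : T -> 'M[R]_(p, n)) (v : T -> 'M[R]_(p, m))
    (a : 'M[R]_(p, n)) (b : 'M[R]_(p, m)) :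
  u t @[t --> F] --> a -> v t @[t --> F] --> b ->
  row_mx (u t) (v t) @[t --> F] --> row_mx a b.
Proof.
move=> ua vb; apply: cvg_mx => i j; case: (split_ordP j) => k ->.
- by rewrite row_mxEl; under eq_cvg do rewrite row_mxEl; exact: cvg_coord.
- by rewrite row_mxEr; under eq_cvg do rewrite row_mxEr; exact: cvg_coord.
Qed.

Lemma cvg_mulmx (u : T -> 'M[R]_(p, n)) (v : T -> 'M[R]_(n, m))
    (a : 'M[R]_(p, n)) (b : 'M[R]_(n, m)) :
  u t @[t --> F] --> a -> v t @[t --> F] --> b ->
  u t *m v t @[t --> F] --> a *m b.
Proof.
move=> ua vb; apply: cvg_mx => i j; rewrite mxE.
under eq_cvg do rewrite mxE.
apply: cvg_big => [|k _]; first exact: add_continuous.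
by apply: cvgM; exact: cvg_coord.
Qed.

Lemma cvg_trmx (u : T -> 'M[R]_(p, n)) (a : 'M[R]_(p, n)) :
  u t @[t --> F] --> a -> (u t)^T @[t --> F] --> a^T.
Proof.
move=> ua; apply: cvg_mx => i j; rewrite mxE.
by under eq_cvg do rewrite mxE; exact: cvg_coord.
Qed.

End cvg_blocks.

(** * The Euclidean inner product and norm *)

Section Euclidean.
Variables (R : realType) (N : nat).
Implicit Types u v w : 'rV[R]_N.

Lemma dotvDl u v w : dotv (u + v) w = dotv u w + dotv v w.
Proof. by rewrite -big_split; apply: eq_bigr => i _; rewrite mxE mulrDl. Qed.

Lemma dotvC u v : dotv u v = dotv v u.
Proof. by apply: eq_bigr => i _; rewrite mulrC. Qed.

Lemma dotvZl a u v : dotv (a *: u) v = a * dotv u v.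
Proof. by rewrite mulr_sumr; apply: eq_bigr => i _; rewrite mxE mulrA. Qed.

Lemma dotv0l u : dotv 0 u = 0.
Proof. by rewrite /dotv big1// => i _; rewrite mxE mul0r. Qed.

Lemma dotv_ge0 u : 0 <= dotv u u.
Proof. by apply: sumr_ge0 => i _; rewrite -expr2 sqr_ge0. Qed.

Lemma enorm_ge0 u : 0 <= enorm u.
Proof. exact: sqrtr_ge0. Qed.

Lemma enorm_sqr u : enorm u ^+ 2 = dotv u u.
Proof. by rewrite sqr_sqrtr// dotv_ge0. Qed.

Lemma enorm0 : enorm (0 : 'rV[R]_N) = 0.
Proof. by rewrite /enorm dotv0l sqrtr0. Qed.

Lemma enormZ a u : 0 <= a -> enorm (a *: u) = a * enorm u.
Proof.
move=> a0; rewrite /enorm dotvZl dotvC dotvZl mulrA -expr2.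
by rewrite sqrtrM ?sqr_ge0// sqrtr_sqr ger0_norm.
Qed.

Lemma enormN u : enorm (- u) = enorm u.
Proof. by rewrite /enorm -scaleN1r dotvZl dotvC dotvZl mulrA mulrNN !mul1r. Qed.

Lemma norm_coord_le_enorm u i j : `|u i j| <= enorm u.
Proof.
rewrite ord1 -(sqrtr_sqr (u 0 j)) ler_sqrt// ?dotv_ge0//.
rewrite /dotv (bigD1 j)//= -expr2 lerDl.
by apply: sumr_ge0 => k _; rewrite -expr2 sqr_ge0.
Qed.

Lemma enorm_gt0 u : u != 0 -> 0 < enorm u.
Proof.
move=> u0; rewrite lt_neqAle enorm_ge0 andbT eq_sym.
apply: contra u0 => /eqP e0; apply/eqP/matrixP => i j; rewrite mxE.
by apply/eqP; rewrite -normr_le0 -e0 norm_coord_le_enorm.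
Qed.

Lemma cvg_enorm (T : Type) (F : set_system T) {FF : Filter F}
    (u : T -> 'rV[R]_N) :
  u t @[t --> F] --> (0 : 'rV[R]_N) -> enorm (u t) @[t --> F] --> (0 : R).
Proof.
move=> u0; rewrite -[X in _ --> X]enorm0.
apply: (@cvg_comp _ _ _ _ Num.sqrt); last exact: sqrt_continuous.
apply: cvg_big => [|k _]; first exact: add_continuous.
by apply: cvgM; exact: cvg_coord.
Qed.

Lemma cvg_enorm0 (T : Type) (F : set_system T) {FF : Filter F}
    (u : T -> 'rV[R]_N) :
  enorm (u t) @[t --> F] --> (0 : R) -> u t @[t --> F] --> (0 : 'rV[R]_N).
Proof.
move=> u0; apply: cvg_mx => i j; rewrite mxE; apply: norm_cvg0.
apply: (@squeeze_cvgr _ _ _ _ (cst 0) (fun t => enorm (u t))) => //;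
  last exact: cvg_cst.
by near=> t; rewrite normr_ge0 norm_coord_le_enorm.
Unshelve. all: by end_near. Qed.

End Euclidean.

Section blocks.
Variables (R : realType) (n m : nat).
Implicit Types u v : 'rV[R]_(n + m).

Lemma dotv_submx u v :
  dotv u v = dotv (lsubmx u) (lsubmx v) + dotv (rsubmx u) (rsubmx v).
Proof.
by rewrite /dotv big_split_ord/=; congr (_ + _); apply: eq_bigr => i _;
  rewrite !mxE.
Qed.

Lemma enorm_lsubmx_le u : enorm (lsubmx u) <= enorm u.
Proof. by rewrite ler_sqrt ?dotv_ge0// [leRHS]dotv_submx lerDl dotv_ge0. Qed.

Lemma enorm_row_mx0 (x : 'rV[R]_n) : enorm (row_mx x (0 : 'rV[R]_m)) = enorm x.
Proof. by rewrite /enorm dotv_submx row_mxKl row_mxKr dotv0l addr0. Qed.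

Lemma enorm_row_0mx (s : 'rV[R]_m) : enorm (row_mx (0 : 'rV[R]_n) s) = enorm s.
Proof. by rewrite /enorm dotv_submx row_mxKl row_mxKr dotv0l add0r. Qed.

End blocks.

(** * Subgradients of an objective that ignores the slack variable *)

(** The epsilon form of the liminf condition.  Clearing the denominator makes the
    bound trivial at [xb], so the neighbourhood need not be punctured and the
    bound pulls back along maps that are not injective, such as (x, s) |-> x. *)
Lemma reg_subdiffP (R : realType) (N : nat) (h : 'rV[R]_N -> \bar R)
    (xb v : 'rV[R]_N) : noninfty_below h ->
  reg_subdiff h xb v <->
  edom h xb /\ forall e : R, 0 < e -> \forall x \near xb,
    (h xb + (dotv v (x - xb) - e * enorm (x - xb))%:E <= h x)%E.
Proof.
move=> hNy.
have quot e x : edom h xb -> x != xb ->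
  ((- e)%:E <= (h x - h xb - (dotv v (x - xb))%:E) / (enorm (x - xb))%:E)%E =
  (h xb + (dotv v (x - xb) - e * enorm (x - xb))%:E <= h x)%E.
  rewrite /edom/= => hxb xxb.
  have E0 : 0 < enorm (x - xb) by rewrite enorm_gt0// subr_eq0.
  rewrite inver gt_eqF// lee_pdivlMr//.
  move: (hNy x) (hNy xb) hxb.
  case: (h x) => [r| |]//; case: (h xb) => [s| |]// _ _ _.
  - rewrite -!EFinB -EFinD -EFinM !lee_fin; apply/idP/idP; lra.
  - by rewrite /= !leey.
rewrite /reg_subdiff/= limf_einfE; split=> -[dx].
- move=> sup0; split=> // e e0.
  have : ((- e)%:E < ereal_sup [set ereal_inf [set
      ((h x - h xb - (dotv v (x - xb))%:E) / (enorm (x - xb))%:E)%E | x in V] |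
      V in xb^'])%E.
    by apply: lt_le_trans sup0; rewrite lte_fin oppr_lt0.
  move=> /ereal_sup_gt[_ [V xbV <-]] eV.
  move: xbV; rewrite /dnbhs /within/=; apply: filterS => x Vx.
  have [->|xxb] := eqVneq x xb.
    by rewrite subrr dotvC dotv0l enorm0 mulr0 subr0 adde0.
  rewrite -quot//; apply: (le_trans (ltW eV)); apply: ge_ereal_inf.
  by eexists; [exists x; [exact: Vx|]|].
- move=> hV; split=> //; apply/lee_subgt0Pr => e e0.
  rewrite sub0e -EFinN.
  apply: le_trans; last first.
    apply: ereal_sup_ubound; exists [set x | x != xb /\
      (h xb + (dotv v (x - xb) - e * enorm (x - xb))%:E <= h x)%E] => //.
    by rewrite /dnbhs /within/=; apply: filterS (hV e e0).
  by apply: le_ereal_inf_tmp => _ [x [xxb hx] <-]; rewrite quot.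
Qed.

Section slack_subdiff.
Variables (R : realType) (n m : nat) (q : 'rV[R]_n -> \bar R).
Hypothesis qNy : noninfty_below q.
Implicit Types w v : 'rV[R]_(n + m).

(** Any minorant of [q] around x, composed with the projection (x, s) |-> x, is a
    minorant of the slack objective, and conversely one restricts to the slice
    of constant s.  The second component vanishes because the objective is
    constant along s. *)
Lemma reg_subdiff_slack_obj w v :
  reg_subdiff (slack_obj q) w v <->
  reg_subdiff q (lsubmx w) (lsubmx v) /\ rsubmx v = 0.
Proof.
have QNy : noninfty_below (@slack_obj R n m q) by move=> x; exact: qNy.
rewrite !reg_subdiffP//; split; last first.
  move=> [[dw hv] v20]; split=> // e e0; have hve := hv e e0.
  have lw : lsubmx x @[x --> w] --> lsubmx w by exact: continuous_lsubmx.
  move: (lw _ hve); rewrite nbhs_simpl/=; apply: filterS => x /= hx.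
  apply: le_trans hx; rewrite leeD2l// lee_fin.
  have := enorm_lsubmx_le (x - w); rewrite linearB/= => le_norm.
  by rewrite dotv_submx v20 dotv0l addr0 linearB/= lerB// ler_pM2l.
move=> [dw hv].
have xNy : slack_obj q w \is a fin_num.
  by rewrite fin_numE QNy lt_eqF.
split.
  split=> [//|e e0]; have hve := hv e e0.
  have lw : row_mx x (rsubmx w) @[x --> lsubmx w] --> w.
    by rewrite -[X in _ --> X]hsubmxK;
      apply: (cvg_row_mx (F := nbhs _)); [exact: cvg_id|exact: cvg_cst].
  move: (lw _ hve); rewrite nbhs_simpl/=; apply: filterS => x /=.
  have -> : row_mx x (rsubmx w) - w = row_mx (x - lsubmx w) 0.
    by rewrite -[w in LHS]hsubmxK opp_row_mx add_row_mx row_mxKr subrr.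
  rewrite /slack_obj row_mxKl enorm_row_mx0 dotv_submx row_mxKl row_mxKr.
  by rewrite [dotv (rsubmx v) 0]dotvC dotv0l addr0.
(* If the slack component v2 of v were nonzero, a small step t > 0 along it would
   leave the objective unchanged, while the minorant with e = |v2| / 2 would rise
   by t |v2|^2 / 2. *)
apply/eqP/negPn/negP => v20.
have ev : 0 < enorm (rsubmx v) by exact: enorm_gt0.
have e0 : 0 < enorm (rsubmx v) / 2 by lra.
have lw : row_mx (lsubmx w) (rsubmx w + t *: rsubmx v) @[t --> (0:R)] --> w.
  rewrite -[X in _ --> X]hsubmxK;
  apply: (cvg_row_mx (F := nbhs _)); first exact: cvg_cst.
  rewrite -[X in _ --> X]addr0 -(scale0r (rsubmx v)).
  by apply: cvgD; [exact: cvg_cst|apply: cvgZr_tmp; exact: cvg_id].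
move: (lw _ (hv _ e0)); rewrite nbhs_simpl/= => ht.
have /filter_ex[t [t0]] : \forall t \near (0:R)^'+, 0 < t /\
   (slack_obj q w + (dotv v (row_mx (lsubmx w) (rsubmx w + t *: rsubmx v) - w) -
      enorm (rsubmx v) / 2 *
        enorm (row_mx (lsubmx w) (rsubmx w + t *: rsubmx v) - w))%:E <=
    slack_obj q (row_mx (lsubmx w) (rsubmx w + t *: rsubmx v)))%E.
  near=> t; split=> //; near: t; exact: cvg_within ht.
have -> : row_mx (lsubmx w) (rsubmx w + t *: rsubmx v) - w =
   row_mx 0 (t *: rsubmx v).
  rewrite -[w in X in _ - X]hsubmxK opp_row_mx add_row_mx subrr.
  by rewrite addrAC subrr add0r.
rewrite {2}/slack_obj row_mxKl -/(slack_obj q w) enorm_row_0mx (enormZ _ (ltW t0)).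
rewrite dotv_submx row_mxKl row_mxKr [dotv (lsubmx v) _]dotvC.
rewrite dotv0l add0r dotvC dotvZl -enorm_sqr.
rewrite -[leRHS]adde0 leeD2lE// lee_fin => t_le.
have tv : 0 < t * enorm (rsubmx v) ^+ 2 by rewrite mulr_gt0// exprn_gt0.
lra.
Unshelve. all: by end_near. Qed.

Lemma subdiff_slack_obj w v :
  subdiff (slack_obj q) w v <-> subdiff q (lsubmx w) (lsubmx v) /\ rsubmx v = 0.
Proof.
split=> [[dw [x_ [v_ [xw qx xv vv]]]]|[[dw [x_ [v_ [xw qx xv vv]]]] v20]].
- split.
  + split=> //; exists (lsubmx \o x_), (lsubmx \o v_); split => //.
    * exact: cvg_lsubmx.
    * by move=> j; have /reg_subdiff_slack_obj[] := xv j.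
    * exact: cvg_lsubmx.
  + have /cvg_rsubmx := vv.
    have -> : (fun j => rsubmx (v_ j)) = cst 0.
      by apply/funext => j; have /reg_subdiff_slack_obj[] := xv j.
    move=> v2; apply: (cvg_unique (@norm_hausdorff R 'rV[R]_m) v2).
    exact: (cvg_cst (0 : 'rV[R]_m)).
- split=> //; exists (fun j => row_mx (x_ j) (rsubmx w)), (fun j => row_mx (v_ j) 0).
  split.
  + by rewrite -[w in _ --> w]hsubmxK; apply: (cvg_row_mx (F := \oo)) => //;
      exact: cvg_cst.
  + rewrite /slack_obj; under eq_cvg do rewrite row_mxKl; exact: qx.
  + move=> j; apply/reg_subdiff_slack_obj; split; last by rewrite row_mxKr.
    by rewrite !row_mxKl; exact: xv.
  + by rewrite -[v]hsubmxK v20; apply: (cvg_row_mx (F := \oo)) => //;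
      exact: cvg_cst.
Qed.

End slack_subdiff.

(** * Normals to the set {0} x D *)

Section slack_normal.
Variables (R : realType) (m : nat) (D : set 'rV[R]_m).

(** The inequality |p - v'|^2 <= |z - v'|^2 for v' = p + s (v - p) amounts to
    0 <= |z - p|^2 + 2 s <z - p, p - v>, which is affine in s. *)
Lemma proj_set_segment (v p : 'rV[R]_m) (s : R) : 0 <= s <= 1 ->
  proj_set D v p -> proj_set D (p + s *: (v - p)) p.
Proof.
move=> /andP[s0 s1] [Dp pv]; split=> // z Dz.
have := pv z Dz; rewrite !ler_sqrt ?dotv_ge0//.
have sqD (a b : 'rV[R]_m) :
    dotv (a + b) (a + b) = dotv a a + 2 * dotv a b + dotv b b.
  rewrite dotvDl [dotv a _]dotvC [dotv b _]dotvC !dotvDl [dotv b a]dotvC; ring.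
have -> : z - v = (z - p) + (p - v) by rewrite addrA subrK.
have -> : z - (p + s *: (v - p)) = (z - p) + s *: (p - v).
  by rewrite opprD addrA -scalerN opprB.
have -> : p - (p + s *: (v - p)) = s *: (p - v).
  by rewrite opprD addrA subrr add0r -scalerN opprB.
rewrite !(sqD (z - p)) [dotv (z - p) (s *: _)]dotvC (dotvZl s _ (z - p)).
rewrite [dotv (p - v) (z - p)]dotvC.
rewrite !lerDr => zp; have zp0 := dotv_ge0 (z - p).
(* Convex combination of the cases s = 0 (trivial) and s = 1 (assumption). *)
have : 0 <= s * (dotv (z - p) (z - p) + 2 * dotv (z - p) (p - v)).
  by rewrite mulr_ge0.
have : 0 <= (1 - s) * dotv (z - p) (z - p) by rewrite mulr_ge0// subr_ge0.
lra.
Qed.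

Lemma proj_set_slack_set (v p : 'rV[R]_(m + m)) :
  proj_set (slack_set D) v p <->
  lsubmx p = 0 /\ proj_set D (rsubmx v) (rsubmx p).
Proof.
have split_dist (z : 'rV[R]_(m + m)) : lsubmx z = 0 -> dotv (z - v) (z - v) =
    dotv (lsubmx v) (lsubmx v) +
    dotv (rsubmx z - rsubmx v) (rsubmx z - rsubmx v).
  move=> z0; rewrite dotv_submx !linearB/= z0 sub0r; congr (_ + _).
  by rewrite -scaleN1r dotvZl dotvC dotvZl mulrA mulrNN !mul1r.
split=> [[[p0 Dp] pv]|[p0 [Dp pv]]].
- split=> //; split=> // z Dz.
  have z0 : lsubmx (row_mx (0 : 'rV[R]_m) z) = 0 by rewrite row_mxKl.
  have zv : D (rsubmx (row_mx (0 : 'rV[R]_m) z)) by rewrite row_mxKr.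
  have := pv (row_mx 0 z) (conj z0 zv).
  by rewrite !ler_sqrt ?dotv_ge0// !split_dist// lerD2l row_mxKr.
- split=> // z [z0 Dz]; have := pv _ Dz.
  by rewrite !ler_sqrt ?dotv_ge0// !split_dist// lerD2l.
Qed.

(** The distance from [v_ j] to its projection is at most its distance to [z]. *)
Lemma cvg_proj_residual (v_ p_ : nat -> 'rV[R]_m) (z : 'rV[R]_m) : D z ->
  (forall j, proj_set D (v_ j) (p_ j)) -> v_ @ \oo --> z ->
  v_ j - p_ j @[j --> \oo] --> (0 : 'rV[R]_m).
Proof.
move=> Dz pv vz; apply: cvg_enorm0.
apply: (@squeeze_cvgr _ _ _ _ (cst 0) (fun j => enorm (z - v_ j))).
- near=> j; rewrite enorm_ge0 -opprB enormN; exact: (pv j).2.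
- exact: cvg_cst.
- apply: cvg_enorm; rewrite -[X in _ --> X](subrr z).
  by apply: cvgB => //; exact: cvg_cst.
Unshelve. all: by end_near. Qed.

Lemma lim_normal_cone_slack_set (z w : 'rV[R]_(m + m)) :
  lim_normal_cone (slack_set D) z w <->
  lsubmx z = 0 /\ lim_normal_cone D (rsubmx z) (rsubmx w).
Proof.
split=> [[[z0 Dz] [v_ [w_ [vz cvw ww]]]]|[z0 [Dz [v_ [w_ [vz cvw ww]]]]]].
- split=> //; split=> //; exists (rsubmx \o v_), (rsubmx \o w_).
  split; [exact: cvg_rsubmx| |exact: cvg_rsubmx].
  move=> j; have [t t0 [_ [p /proj_set_slack_set[_ pv] <-] wE]] := cvw j.
  exists t => //; exists (rsubmx (v_ j) - rsubmx p); first by exists (rsubmx p).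
  by rewrite /= wE linearZ/= linearB.
- have cvw' j : exists tp : R * 'rV[R]_m,
      [/\ 0 <= tp.1, proj_set D (v_ j) tp.2 & w_ j = tp.1 *: (v_ j - tp.2)].
    by have [t t0 [_ [p pv <-] wE]] := cvw j; exists (t, p).
  have [tp tpP] := choice cvw'.
  pose t j := (tp j).1; pose p j := (tp j).2.
  have t0 j : 0 <= t j by have [] := tpP j.
  have pv j : proj_set D (v_ j) (p j) by have [] := tpP j.
  have wE j : w_ j = t j *: (v_ j - p j) by have [] := tpP j.
  (* The scale T dominates t and tends to infinity.  The base point is moved so
     that its residual is (t / T) (v - p), which T scales to t (v - p) = w. *)
  pose T j : R := t j + j.+1%:R.
  have T0 j : 0 < T j by rewrite /T ltr_wpDl.
  have TV0 : (T j)^-1 @[j --> \oo] --> (0 : R).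
    apply: (@squeeze_cvgr _ _ _ _ (cst 0) (fun j => j.+1%:R^-1)).
    + near=> j; rewrite invr_ge0 ltW//= lef_pV2 ?posrE//.
      by rewrite /T lerDr.
    + exact: cvg_cst.
    + exact: cvg_harmonic.
  have s01 j : 0 <= t j / T j <= 1.
    rewrite divr_ge0 ?(ltW (T0 j))//= ler_pdivrMr// mul1r /T.
    by rewrite lerDl.
  have vp0 := cvg_proj_residual Dz pv vz.
  split=> //.
  exists (fun j => row_mx ((T j)^-1 *: lsubmx w)
                          (p j + (t j / T j) *: (v_ j - p j))).
  exists (fun j => row_mx (lsubmx w) (w_ j)).
  split.
  + rewrite -[z]hsubmxK z0; apply: (cvg_row_mx (F := \oo)).
      by rewrite -(scale0r (lsubmx w)); apply: cvgZr_tmp.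
    have -> : (fun j => p j + (t j / T j) *: (v_ j - p j)) =
        (fun j => v_ j - (1 - t j / T j) *: (v_ j - p j)).
      by apply/funext => j; apply/matrixP => i k; rewrite !mxE; ring.
    rewrite -[X in _ --> X]subr0; apply: cvgB => //.
    apply: cvg_enorm0.
    apply: (@squeeze_cvgr _ _ _ _ (cst 0) (fun j => enorm (v_ j - p j))).
    * near=> j; have /andP[s0 s1] := s01 j.
      rewrite enorm_ge0 enormZ ?subr_ge0//= ler_piMl ?enorm_ge0//.
      by rewrite gerBl.
    * exact: cvg_cst.
    * exact: cvg_enorm.
  + move=> j; exists (T j); first exact: ltW.
    exists (row_mx ((T j)^-1 *: lsubmx w) ((t j / T j) *: (v_ j - p j))).
      exists (row_mx 0 (p j)).
        apply/proj_set_slack_set; rewrite row_mxKl !row_mxKr; split=> //.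
        exact: proj_set_segment.
      by rewrite opp_row_mx add_row_mx subr0 [p j + _]addrC addrK.
    rewrite scale_row_mx !scalerA divff ?gt_eqF// scale1r wE.
    by rewrite [T j * _]mulrC divfK ?gt_eqF.
  + by rewrite -[w in _ --> w]hsubmxK; apply: (cvg_row_mx (F := \oo)) => //;
      exact: cvg_cst.
Unshelve. all: by end_near. Qed.

End slack_normal.

(** * The Jacobian of the slack constraint map *)

Section slack_jacobian.
Variables (R : realType) (n m : nat) (c : 'rV[R]_n -> 'rV[R]_m).

Lemma is_diff_mulmxr (p k : nat) (A : 'M[R]_(p, k)) (x : 'rV[R]_p) :
  is_diff x (mulmxr A : 'rV[R]_p -> 'rV[R]_k) (mulmxr A).
Proof.
have cA : continuous (mulmxr A : 'rV[R]_p -> 'rV[R]_k).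
  move=> y; apply: (cvg_mulmx (F := nbhs y)); [exact: cvg_id|exact: cvg_cst].
apply: DiffDef; first exact: linear_differentiable.
exact: diff_lin.
Qed.

Lemma jacobian_slack_map (w : 'rV[R]_(n + m)) :
  differentiable c (lsubmx w) ->
  'J (slack_map c) w = block_mx ('J c (lsubmx w)) 0 (- 1%:M) 1%:M.
Proof.
move=> dc.
(* The map is (x, s) |-> c(x) A + (x, s) B, with x = (x, s) L. *)
pose A : 'M[R]_(m, m + m) := row_mx 1%:M 0.
pose B : 'M[R]_(n + m, m + m) := block_mx 0 0 (- 1%:M) 1%:M.
pose L : 'M[R]_(n + m, n) := col_mx 1%:M 0.
have lE (u : 'rV[R]_(n + m)) : u *m L = lsubmx u.
  by rewrite -[u in LHS]hsubmxK mul_row_col mulmx1 mulmx0 addr0.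
have BE (u : 'rV[R]_(n + m)) : u *m B = row_mx (- rsubmx u) (rsubmx u).
  rewrite -[u in LHS]hsubmxK mul_row_block !mulmx0 !add0r mulmx1.
  by rewrite mulmxN mulmx1.
have AE (u : 'rV[R]_m) : u *m A = row_mx u 0.
  by rewrite mul_mx_row mulmx1 mulmx0.
have sE : slack_map c = (mulmxr A \o (c \o mulmxr L)) + mulmxr B.
  apply/funext => u; rewrite /slack_map -[RHS]/((c (u *m L)) *m A + u *m B).
  by rewrite lE AE BE add_row_mx add0r.
have dcw : is_diff (mulmxr L w) c ('d c (lsubmx w)).
  by rewrite /= lE; exact: differentiableP.
have dw := is_diffD (is_diff_comp (is_diff_comp (is_diff_mulmxr L w) dcw)
  (is_diff_mulmxr A _)) (is_diff_mulmxr B w).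
have eqd (u : 'rV[R]_(n + m)) : 'd (slack_map c) w u =
    row_mx (lsubmx u *m 'J c (lsubmx w) - rsubmx u) (rsubmx u).
  rewrite sE diff_val.
  rewrite -[LHS]/(('d c (lsubmx w) (u *m L)) *m A + u *m B).
  by rewrite lE AE BE add_row_mx add0r /jacobian mul_rV_lin1.
apply/row_matrixP => i; rewrite !rowE /jacobian mul_rV_lin1 eqd.
rewrite -[delta_mx 0 i in RHS]hsubmxK mul_row_block mulmx0 add0r.
by rewrite mulmxN !mulmx1.
Qed.

End slack_jacobian.

(** * Transfer of asymptotic stationarity *)

Section AM_slack.
Variables (R : realType) (n m : nat).
Variables (q : 'rV[R]_n -> \bar R) (c : 'rV[R]_n -> 'rV[R]_m).
Variables (D : set 'rV[R]_m) (xs : 'rV[R]_n).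
Hypothesis qNy : noninfty_below q.
Hypothesis c_diff : forall x, differentiable c x.
Hypothesis c_jac_cont : continuous (jacobian c).

Lemma mulmx_tr_jacobian_slack_map (w : 'rV[R]_(n + m)) (y : 'rV[R]_(m + m)) :
  y *m ('J (slack_map c) w)^T =
  row_mx (lsubmx y *m ('J c (lsubmx w))^T) (rsubmx y - lsubmx y).
Proof.
rewrite jacobian_slack_map// tr_block_mx -[y in LHS]hsubmxK mul_row_block.
by rewrite trmx0 linearN/= !trmx1 mulmx0 addr0 mulmxN !mulmx1 addrC.
Qed.

Lemma cvg_jacobian_seq (x_ : nat -> 'rV[R]_n) :
  x_ @ \oo --> xs -> 'J c (x_ j) @[j --> \oo] --> 'J c xs.
Proof.
move=> xx; apply: (@cvg_comp _ _ _ x_ (jacobian c) _ _ _ xx).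
exact: c_jac_cont.
Qed.

Lemma AM_stationary_slack :
  AM_stationary q c D xs ->
  AM_stationary (slack_obj q) (slack_map c) (slack_set D) (row_mx xs (c xs)).
Proof.
move=> [[dq Dc] [x_ [eta [y [zeta [xx qx e0 z0 st]]]]]].
split.
  split; first by rewrite /edom/= /slack_obj row_mxKl.
  by rewrite /slack_set/slack_map/= !row_mxKl !row_mxKr subrr.
exists (fun k => row_mx (x_ k) (c (x_ k))), (fun k => row_mx (eta k) 0).
exists (fun k => row_mx (y k) (y k)), (fun k => row_mx 0 (zeta k)).
split.
- apply: (cvg_row_mx (F := \oo)) => //.
  apply: (@cvg_comp _ _ _ x_ c _ (nbhs xs) (nbhs (c xs)) xx).
  exact: (differentiable_continuous (c_diff xs)).
- by rewrite /slack_obj row_mxKl; under eq_cvg do rewrite row_mxKl.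
- rewrite -row_mx0; apply: (cvg_row_mx (F := \oo)) => //; exact: cvg_cst.
- rewrite -row_mx0; apply: (cvg_row_mx (F := \oo)) => //; exact: cvg_cst.
- move=> k; have [sk nk] := st k; split.
  + apply/subdiff_slack_obj => //; rewrite mulmx_tr_jacobian_slack_map.
    by rewrite !linearD/= !linearN/= !row_mxKl !row_mxKr subrr oppr0 addr0.
  + apply/lim_normal_cone_slack_set; rewrite !linearD/= /slack_map.
    by rewrite !row_mxKl !row_mxKr subrr add0r.
Qed.

Lemma AM_stationary_of_slack : feasible q c D xs ->
  AM_stationary (slack_obj q) (slack_map c) (slack_set D) (row_mx xs (c xs)) ->
  AM_stationary q c D xs.
Proof.
move=> feas [_ [w_ [eta [y [zeta [ww qw e0 z0 st]]]]]].
have xx : lsubmx (w_ k) @[k --> \oo] --> xs.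
  by rewrite -[xs](row_mxKl xs (c xs)); exact: cvg_lsubmx.
split=> //.
exists (fun k => lsubmx (w_ k)).
exists (fun k => lsubmx (eta k) + rsubmx (eta k) *m ('J c (lsubmx (w_ k)))^T).
exists (fun k => rsubmx (y k)), (fun k => lsubmx (zeta k) + rsubmx (zeta k)).
split.
- exact: xx.
- by move: qw; rewrite /slack_obj row_mxKl.
- rewrite [X in _ --> X](_ : _ = lsubmx (0 : 'rV[R]_(n + m)) +
      rsubmx (0 : 'rV[R]_(n + m)) *m ('J c xs)^T); last first.
    by rewrite !linear0 mul0mx addr0.
  apply: cvgD; first exact: cvg_lsubmx.
  apply: (cvg_mulmx (F := \oo)); first exact: cvg_rsubmx.
  by apply: (cvg_trmx (F := \oo)); exact: cvg_jacobian_seq.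
- rewrite [X in _ --> X](_ : _ = lsubmx (0 : 'rV[R]_(m + m)) +
      rsubmx (0 : 'rV[R]_(m + m))); last by rewrite !linear0 addr0.
  by apply: cvgD; [exact: cvg_lsubmx|exact: cvg_rsubmx].
- move=> k; have [/subdiff_slack_obj-/(_ qNy)[]] := st k.
  rewrite mulmx_tr_jacobian_slack_map !linearD/= !linearN/= row_mxKl row_mxKr.
  move=> sk /eqP; rewrite addrC subr_eq0 => /eqP eE.
  move=> /lim_normal_cone_slack_set[]; rewrite !linearD/= /slack_map.
  rewrite row_mxKl row_mxKr => zE nk; split.
  + have -> : - (rsubmx (y k) *m ('J c (lsubmx (w_ k)))^T) +
        (lsubmx (eta k) + rsubmx (eta k) *m ('J c (lsubmx (w_ k)))^T) =
        - (lsubmx (y k) *m ('J c (lsubmx (w_ k)))^T) + lsubmx (eta k).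
      by rewrite eE mulmxBl addrCA addKr addrC.
    exact: sk.
  + suff -> : c (lsubmx (w_ k)) + (lsubmx (zeta k) + rsubmx (zeta k)) =
      rsubmx (w_ k) + rsubmx (zeta k) by [].
    by rewrite addrA; congr (_ + _); apply/eqP; rewrite -subr_eq0 addrAC zE.
Qed.

End AM_slack.

Unset Implicit Arguments.
Set Strict Implicit.
Set Printing Implicit Defensive.

Theorem lemma3p1 (R : realType) (n m : nat)
    (f : 'rV[R]_n -> R) (c : 'rV[R]_n -> 'rV[R]_m) (g : 'rV[R]_n -> \bar R)
    (D : set 'rV[R]_m)
    (f_diff : forall x, differentiable f x)
    (f_grad_cont : continuous (grad f))
    (f_grad_lip : locally_lipschitz (grad f))
    (c_diff : forall x, differentiable c x)
    (c_jac_cont : continuous (jacobian c))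
    (c_jac_lip : locally_lipschitz (jacobian c))
    (g_noninfty : noninfty_below g)
    (g_proper : proper_fun g)
    (g_lsc : lower_semicontinuous g)
    (g_prox : prox_bounded g)
    (D_nonempty : D !=set0)
    (D_closed : closed D)
    (xs : 'rV[R]_n) :
  let q : 'rV[R]_n -> \bar R := fun x => ((f x)%:E + g x)%E in
  feasible q c D xs ->
  AM_stationary q c D xs <->
  AM_stationary (slack_obj q) (slack_map c) (slack_set D) (row_mx xs (c xs)).
Proof.
move=> q feas.
have qNy : noninfty_below q.
  by move=> x; rewrite /q; move: (g_noninfty x); case: (g x).
split; first exact: AM_stationary_slack.
exact: AM_stationary_of_slack.
Qed.
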